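(* Let $\mathcal{L}$ be a finite atomic lattice with set of atoms $S$, let $\mathcal{B}$ be an $\mathcal{L}$-building set, and let $\mathcal{B}'$ be the boolean building closure of $\{S_{\le B}:B\in\mathcal{B}\}$. Then the $\mathcal{L}$-nested complex of $\mathcal{B}$ is realized by (i) a subfan of the boolean nested fan $\Sigma(\mathcal{B}')$, and (ii) a subcomplex of the boundary complex of the polar of the boolean nestohedron $\mathrm{Nest}(\mathcal{B}')$.
   Context: A lattice is atomic if every element is a join of atoms. For $X\in\mathcal{L}$, $S_{\le X}=\{s\in S:s\le X\}$. For a finite lattice $\mathcal{L}$ with bottom $\hat 0$, an $\mathcal{L}$-building set is a subset $\mathcal{B}\subseteq\mathcal{L}_{>\hat 0}$ such that for every $Y\in\mathcal{L}_{>\hat 0}$, with $\{B_1,\dots,B_k\}=\max(\mathcal{B}_{\le Y})$, there is a poset isomorphism $\prod_{j}\mathcal{L}_{\le B_j}\to\mathcal{L}_{\le Y}$ whose $j$-th component is the inclusion. Let $\kappa(\mathcal{B})=\max(\mathcal{B})$. An $\mathcal{L}$-nested set on $\mathcal{B}$ is a subset $\mathcal{N}\subseteq\mathcal{B}$ containing $\kappa(\mathcal{B})$ such that for any $k\ge2$ pairwise incomparable $B_1,\dots,B_k\in\mathcal{N}\setminus\kappa(\mathcal{B})$, the join $B_1\vee\cdots\vee B_k$ is not in $\mathcal{B}$. The $\mathcal{L}$-nested complex of $\mathcal{B}$ is the simplicial complex with faces $\mathcal{N}\setminus\kappa(\mathcal{B})$. A boolean building set on $S$ is a set $\mathcal{B}'$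 of non-empty subsets of $S$ containing all singletons and such that two intersecting members have their union in $\mathcal{B}'$. The boolean building closure of a collection of subsets of $S$ is the smallest boolean building set on $S$ containing it. A nested set on $\mathcal{B}'$ is a subset $\mathcal{N}\subseteq\mathcal{B}'$ containing the set $\kappa(\mathcal{B}')$ of inclusion-maximal elements of $\mathcal{B}'$, such that any two elements are nested or disjoint, and the union of any $k\ge2$ pairwise disjoint elements is not in $\mathcal{B}'$. The boolean nested complex of $\mathcal{B}'$ has faces $\mathcal{N}\setminus\kappa(\mathcal{B}')$. Let $(e_s)_{s\in S}$ be the standard basis of $\mathbb{R}^S$ and $e_B=\sum_{s\in B}e_s$. The nested fan $\Sigma(\mathcal{B}')$ is the simplicial fan in $\mathbb{R}^S$ consisting of the cones generated by $\{e_B:B\in\mathcal{N}\}$ for all faces $\mathcal{N}$ of the boolean nested complex of $\mathcal{B}'$. The nestohedron $\mathrm{Nest}(\mathcal{B}')=\mathrm{Nest}(\mathcal{B}',\lambda)$ is the Minkowski sum $\sum_{B\in\mathcal{B}'}\lambda_B\,\mathrm{conv}\{e_b:b\in B\}$ for any fixed real coefficients $\lambda_B$ with $\lambda_B>0$ whenever $|B|\ge2$. The boundary complex of the polar of a polytope $Q$ is, as a poset, the set of non-empty faces of $Q$ ordered by reverse inclusion. A simplicial complex is realized by a fan or polyhedral complex if its face poset is isomorphic to the face poset of that fan or complex. *)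

(* Defs.v *)
From mathcomp Require Import all_boot all_order all_algebra.
From mathcomp Require Import boolp classical_sets functions cardinality reals.
Set Implicit Arguments.
Unset Strict Implicit.
Unset Printing Implicit Defensive.
Import Order.TTheory GRing.Theory Num.Theory.

Local Open Scope set_scope.
Local Open Scope ring_scope.

(* A poset is given by its carrier, a subset of an ambient type, and its order
   relation. *)
Definition poset_iso (T U : Type) (A : set T) (leA : T -> T -> Prop)
    (P : set U) (leP : U -> U -> Prop) (f : T -> U) : Prop :=
  set_bij A P f /\
  forall x y, A x -> A y -> (leA x y <-> leP (f x) (f y)).

Definition max_elements (T : finType) (r : rel T) (A : {set T}) : {set T} :=
  [set x in A | [forall y in A, r x y ==> (y == x)]].

Section AtomicLattices.
Context {disp : Order.disp_t} (L : finTBLatticeType disp).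
Implicit Types (x y : L) (B N : {set L}).

Definition atom (x : L) : bool :=
  (x != \bot%O) && [forall y : L, (y < x)%O ==> (y == \bot%O)].

Local Notation atoms := {x : L | atom x}.

Definition atomic : Prop :=
  forall x : L, exists A : {set atoms}, x = (\join_(s in A) val s)%O.

Definition atoms_below (x : L) : {set atoms} := [set s | (val s <= x)%O].

(* An element of the product of the intervals [\bot, b], for b in M, is
   represented by a finite function on L that takes the value \bot outside
   M. *)
Definition interval_prod (M : {set L}) : set {ffun L -> L} :=
  [set g | forall b, if b \in M then (g b <= b)%O else g b == \bot%O]%classic.

Definition interval_prod_le (M : {set L}) (g h : {ffun L -> L}) : Prop :=
  forall b, b \in M -> (g b <= h b)%O.

Definition interval_prod_inj (b x : L) : {ffun L -> L} :=
  [ffun c => if c == b then x else \bot%O].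

Definition lattice_kappa (B : {set L}) : {set L} := max_elements <=%O B.

Definition lattice_building_set (B : {set L}) : Prop :=
  \bot%O \notin B /\
  forall y : L, y != \bot%O ->
    let M := lattice_kappa [set b in B | (b <= y)%O] in
    exists phi : {ffun L -> L} -> L,
      poset_iso (interval_prod M) (interval_prod_le M)
        [set x | (x <= y)%O]%classic (fun x x' => (x <= x')%O) phi /\
      forall b x, b \in M -> (x <= b)%O -> phi (interval_prod_inj b x) = x.

Definition lattice_nested_set (B N : {set L}) : bool :=
  [&& N \subset B, lattice_kappa B \subset N &
      [forall C : {set L},
        [&& C \subset N :\: lattice_kappa B, (1 < #|C|)%N &
            [forall x in C, forall y in C, (x != y) ==> (x >< y)%O]]
        ==> ((\join_(x in C) x)%O \notin B)]].

Definition lattice_nested_complex (B : {set L}) : {set {set L}} :=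
  [set N :\: lattice_kappa B | N in [set N | lattice_nested_set B N]].

End AtomicLattices.

Notation atoms L := {x : L | atom x}.

Section BooleanBuildingSets.
Variable T : finType.
Implicit Types (B C N : {set {set T}}).

Definition boolean_building_set (B : {set {set T}}) : bool :=
  [&& finset.set0 \notin B, [forall s : T, [set s] \in B] &
      [forall X in B, forall Y in B, (X :&: Y != finset.set0) ==> (X :|: Y \in B)]].

Definition boolean_closure (C : {set {set T}}) : {set {set T}} :=
  \bigcap_(B : {set {set T}} | boolean_building_set B && (C \subset B)) B.

Lemma boolean_closure_sub C : C \subset boolean_closure C.
Proof. by apply/finset.bigcapsP => B /andP[]. Qed.

Lemma boolean_closure_min C B :
  boolean_building_set B -> C \subset B -> boolean_closure C \subset B.
Proof. by move=> bB CB; apply: finset.bigcap_inf; rewrite bB. Qed.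

Lemma boolean_closure_building C :
  finset.set0 \notin C -> boolean_building_set (boolean_closure C).
Proof.
move=> C0; apply/and3P; split.
- have full : boolean_building_set [set X : {set T} | X != finset.set0].
    apply/and3P; split; first by rewrite inE eqxx.
      by apply/forallP => s; rewrite inE -card_gt0 cards1.
    apply/'forall_implyP => X X0; apply/'forall_implyP => Y _.
    by apply/implyP => _; move: X0; rewrite !inE finset.setU_eq0 negb_and => ->.
  have Cfull : C \subset [set X : {set T} | X != finset.set0].
    by apply/fintype.subsetP => X XC; rewrite inE; apply: contraNneq C0 => <-.
  apply/negP => /(fintype.subsetP (boolean_closure_min full Cfull)).
  by rewrite inE eqxx.
- by apply/forallP => s; apply/finset.bigcapP => B /andP[/and3P[_ /forallP/(_ s)]].
- apply/'forall_implyP => X /finset.bigcapP XC; apply/'forall_implyP => Y /finset.bigcapP YC.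
  apply/implyP => XY; apply/finset.bigcapP => B Bb; have /andP[/and3P[_ _ BU] _] := Bb.
  move/'forall_implyP: BU => /(_ X (XC _ Bb)) /'forall_implyP.
  by move=> /(_ Y (YC _ Bb)) /implyP; apply.
Qed.

Definition boolean_kappa (B : {set {set T}}) : {set {set T}} :=
  max_elements (fun X Y : {set T} => X \subset Y) B.

Definition boolean_nested_set (B N : {set {set T}}) : bool :=
  [&& N \subset B, boolean_kappa B \subset N,
      [forall X in N, forall Y in N,
        [|| X \subset Y, Y \subset X | [disjoint X & Y]]] &
      [forall C : {set {set T}},
        [&& C \subset N, (1 < #|C|)%N & finset.trivIset C] ==> (finset.cover C \notin B)]].

Definition boolean_nested_complex (B : {set {set T}}) : {set {set {set T}}} :=
  [set N :\: boolean_kappa B | N in [set N | boolean_nested_set B N]].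

End BooleanBuildingSets.

Section Polyhedra.
Variables (R : realType) (T : finType).

(* R^o is R as a module over itself: this gives V its vector space
   structure. *)
Local Notation V := {ffun T -> R^o}.

Definition dot (c x : V) : R := \sum_s (c s : R) * (x s : R).

Definition basis_vec (b : T) : V := [ffun s => (s == b)%:R].

Definition indic_vec (B : {set T}) : V := \sum_(s in B) basis_vec s.

Definition cone (I : finType) (A : {set I}) (v : I -> V) : set V :=
  [set x | exists2 t : I -> R, (forall i, i \in A -> 0 <= t i) &
           x = \sum_(i in A) t i *: v i]%classic.

Definition conv (I : finType) (A : {set I}) (v : I -> V) : set V :=
  [set x | exists t : I -> R,
    [/\ forall i, i \in A -> 0 <= t i, \sum_(i in A) t i = 1 &
        x = \sum_(i in A) t i *: v i]]%classic.

Definition minkowski_sum (I : finType) (A : {set I}) (P : I -> set V) : set V :=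
  [set x | exists2 p : I -> V, (forall i, i \in A -> P i (p i)) &
           x = \sum_(i in A) p i]%classic.

Definition dilate (a : R) (P : set V) : set V :=
  [set a *: x | x in P]%classic.

Definition polyhedral_cone (C : set V) : Prop :=
  exists (n : nat) (v : 'I_n -> V), C = cone [set: 'I_n] v.

Definition cone_face (C F : set V) : Prop :=
  exists2 c : V, (forall x, C x -> 0 <= dot c x) &
                 F = [set x | C x /\ dot c x = 0]%classic.

Definition is_fan (Sigma : set (set V)) : Prop :=
  [/\ finite_set Sigma,
      forall C, Sigma C -> polyhedral_cone C,
      forall C F, Sigma C -> cone_face C F -> Sigma F &
      forall C D, Sigma C -> Sigma D ->
        cone_face C (C `&` D)%classic /\ cone_face D (C `&` D)%classic].

Definition subfan (Sigma' Sigma : set (set V)) : Prop :=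
  is_fan Sigma' /\ (Sigma' `<=` Sigma)%classic.

Definition nested_fan (B : {set {set T}}) : set (set V) :=
  [set C | exists2 N, N \in boolean_nested_complex B &
           C = cone N indic_vec]%classic.

Definition nestohedron (B : {set {set T}}) (lam : {set T} -> R) : set V :=
  minkowski_sum B (fun X => dilate (lam X) (conv X basis_vec)).

(* The faces of a polytope, apart from the empty one, are the sets of maximizers
   of linear functionals; c = 0 gives the polytope itself. *)
Definition nonempty_face (Q F : set V) : Prop :=
  (F !=set0)%classic /\
  exists c : V,
    F = [set x | Q x /\ forall y, Q y -> dot c y <= dot c x]%classic.

(* Reverse inclusion: Q itself is the empty face of the boundary complex of the
   polar of Q. *)
Definition polar_boundary_le (F G : set V) : Prop := (G `<=` F)%classic.

Definition polar_boundary (Q : set V) : set (set V) :=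
  [set F | nonempty_face Q F]%classic.

Definition polar_boundary_subcomplex (Q : set V) (K : set (set V)) : Prop :=
  (K `<=` polar_boundary Q)%classic /\
  forall F G, K F -> polar_boundary Q G -> polar_boundary_le G F -> K G.

End Polyhedra.

(* Both face posets include the empty face of the simplicial complex. *)
Definition realized_by (I : finType) (Delta : {set {set I}})
    (U : Type) (P : set U) (leP : U -> U -> Prop) : Prop :=
  exists f : {set I} -> U,
    poset_iso [set` Delta]%classic (fun N M : {set I} => N \subset M) P leP f.

(* Main.v *)
Require Import Defs.
From mathcomp Require Import all_boot all_order all_algebra.
From mathcomp Require Import boolp classical_sets functions cardinality reals.
From mathcomp Require Import fintype finset.
Set Implicit Arguments.
Unset Strict Implicit.
Unset Printing Implicit Defensive.
Import Order.TTheory GRing.Theory Num.Theory.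

Local Open Scope ring_scope.

(** Write S_x for the set of atoms below x. Since L is atomic, x |-> S_x embeds
L into the subsets of S and x is the join of S_x, so N |-> {S_b : b in N} is an
order embedding on sets of lattice elements. The theorem follows from two facts.

First, this embedding sends the nested complex of B onto a subcomplex of the
nested complex of B'. The decomposition of intervals in a building set forces
the join of two members of B with a common atom to lie in B
([building_join]); hence the subsets X of S with join in B form a boolean
building set, which contains B' ([closure_join_in_building]). A violation of
nestedness among the sets S_b therefore pushes down, by taking joins, to a
violation among the b ([nested_set_atoms_below]).

Second, every subcomplex of a boolean nested complex is realized by the
corresponding cones and by the corresponding faces of the nestohedron. Both
realizations are read off from one combinatorial invariant. For N in the
boolean nested complex and X in the building set, let [bottom N X] be the set of
points of X that lie in no member of N other than those containing X.
 - It is never empty ([bottom_neq0]): otherwise the maximal members of N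
   meeting X without containing it would be disjoint sets covering X, and their
   union would be in the building set.
 - The family ([bottom N X])_X determines N, and is antitone in N
   ([bottom_inj]).
 - It is the family of minimum loci: a combination c of the vectors e_B, B in
   N, with positive coefficients attains its minimum over X exactly on
   [bottom N X] ([argmin_sum_indic_vec]).
 - If the minimum loci of an arbitrary functional c contain the sets
   [bottom N X], then they are the sets [bottom A X] for a subset A of N
   ([argmin_coarsening]).

For the fan, the third point makes a vector in the intersection of two cones
have the same support in both, so that the cones intersect in the cone of the
common generators ([nested_coneI]); differences of coordinates at a point of
[bottom A X] and one of [bottom N X] provide supporting functionals
([nested_cone_functional]). For the nestohedron, the face of a Minkowski sum of
simplices that minimizes c is determined by the minimum loci of c over the
summands, and inclusion of faces is inclusion of these loci ([min_face_sub]);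
so the faces containing the face of N are exactly those of the subsets of N. *)

(** * Maximal elements and bottom sets *)

(** The relation r being a partial order, an element of A above x with the most
elements of A below it is maximal. *)
Lemma max_elements_above (T : finType) (r : rel T) (A : {set T}) (x : T) :
  reflexive r -> transitive r -> antisymmetric r -> x \in A ->
  exists2 y, y \in max_elements r A & r x y.
Proof.
move=> rr rt ra xA.
pose below y := [set z in A | r z y].
have x0 : [pred y in A | r x y] x by rewrite /= xA rr.
case: (arg_maxnP (fun y => #|below y|) x0) => y /andP[yA rxy] ymax.
exists y => //; rewrite inE yA /=.
apply/'forall_implyP => z zA; apply/implyP => ryz.
have sub : below y \subset below z.
  by apply/subsetP => w; rewrite !inE => /andP[-> /rt]; apply.
have : below y == below z.
  by rewrite eqEcard sub; apply: ymax; rewrite /= zA (rt _ _ _ rxy ryz).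
move=> /eqP/setP/(_ z); rewrite !inE zA rr /= => rzy.
by apply/eqP/ra; rewrite rzy ryz.
Qed.

Lemma sub_max_elements (T : finType) (A : {set {set T}}) (X : {set T}) : X \in A ->
  exists2 P, P \in max_elements (fun Y Z : {set T} => Y \subset Z) A & X \subset P.
Proof.
apply: max_elements_above => [Y|Y X' Z|Y Z YZ]; first exact: subxx.
  exact: subset_trans.
by apply/eqP; rewrite eqEsubset.
Qed.

Section Bottom.
Context {T : finType}.
Variable BB : {set {set T}}.
Hypothesis BBbuild : boolean_building_set BB.
Implicit Types (X Y P : {set T}) (A M N C : {set {set T}}).

Lemma building_nonempty X : X \in BB -> exists s, s \in X.
Proof.
case/and3P: BBbuild => B0 _ _ XB; apply/set0Pn.
by apply: contraNneq B0 => <-.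
Qed.

Lemma building_setU X Y s :
  X \in BB -> Y \in BB -> s \in X -> s \in Y -> X :|: Y \in BB.
Proof.
case/and3P: BBbuild => _ _ /'forall_implyP BU XB YB sX sY.
move/'forall_implyP: (BU X XB) => /(_ Y YB) /implyP; apply.
by apply/set0Pn; exists s; rewrite inE sX.
Qed.

(** The members of C may be disjoint from each other: each of them meets X, so they
are absorbed one by one. *)
Lemma building_setU_cover X C :
  X \in BB -> C \subset BB -> (forall Y, Y \in C -> exists2 s, s \in X & s \in Y) ->
  X :|: cover C \in BB.
Proof.
move=> XB /subsetP CB XC; rewrite /cover.
apply: (big_rec (fun Z => X :|: Z \in BB)); first by rewrite setU0.
move=> Y Z YC XZ; have [s sX sY] := XC Y YC.
rewrite setUCA; apply: (building_setU (CB Y YC) XZ sY).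
by rewrite inE sX.
Qed.

Lemma boolean_kappa_sub P : P \in boolean_kappa BB -> P \in BB.
Proof. by rewrite inE => /andP[]. Qed.

(** Otherwise the union of P and X would be a larger member of the building set. *)
Lemma meets_boolean_kappa P X s :
  P \in boolean_kappa BB -> X \in BB -> s \in P -> s \in X -> X \subset P.
Proof.
move=> Pk XB sP sX.
have := building_setU (boolean_kappa_sub Pk) XB sP sX.
move: Pk; rewrite inE => /andP[_ /'forall_implyP Pmax] /Pmax.
by rewrite subsetUl /= => /eqP <-; rewrite subsetUr.
Qed.

(** The condition on s reads: every member of N through s contains X. Equivalently,
s minimizes over X the number of members of N containing it, as soon as this set
is non-empty. *)
Definition bottom N X : {set T} :=
  [set s in X | [forall B in N, (s \in B) ==> (X \subset B)]].

Lemma bottomP N X s :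
  reflect (s \in X /\ forall B, B \in N -> s \in B -> X \subset B) (s \in bottom N X).
Proof.
rewrite inE; apply: (iffP andP) => -[sX]; first by move=> /'forall_implyP H;
  split=> // B /H /implyP.
by move=> H; split=> //; apply/'forall_implyP => B /H/implyP.
Qed.

Lemma bottom_anti A N X : A \subset N -> bottom N X \subset bottom A X.
Proof.
move=> /subsetP AN; apply/subsetP => s /bottomP[sX H]; apply/bottomP.
by split=> // B /AN /H.
Qed.

Lemma nested_laminar N X Y s : boolean_nested_set BB N ->
  X \in N -> Y \in N -> s \in X -> s \in Y -> X \subset Y \/ Y \subset X.
Proof.
case/and4P=> _ _ /'forall_implyP lam _ XN YN sX sY.
have /'forall_implyP/(_ Y YN)/or3P[] := lam X XN; [by left | by right |].
by move=> /pred0P/(_ s) /=; rewrite sX sY.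
Qed.

(** If every point of X were in a member of N not containing X, then the maximal
members of N that meet X without containing it would cover X. They are pairwise
disjoint because N is laminar, and their union, which absorbs X, belongs to the
building set. Nestedness leaves only one of them, which would then contain X. *)
Lemma bottom_nonempty N X :
  boolean_nested_set BB N -> X \in BB -> exists s, s \in bottom N X.
Proof.
move=> nN XB; apply/set0Pn/negP => /eqP b0.
have [/subsetP NB _ _ /forallP disj] := and4P nN.
pose A := [set B in N | ~~ (X \subset B) & X :&: B != set0].
pose C := max_elements (fun X Y => X \subset Y) A.
have CA B : B \in C -> B \in A by rewrite inE => /andP[].
have CN : C \subset N.
  by apply/subsetP => B /CA; rewrite inE => /andP[].
have XC : X \subset cover C.
  apply/subsetP => s sX.
  have : s \notin bottom N X by rewrite b0 inE.
  rewrite inE sX /= negb_forall => /existsP[B].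
  rewrite !negb_imply => /and3P[BN sB XB'].
  have BA : B \in A by rewrite inE BN XB'; apply/set0Pn; exists s; rewrite inE sX.
  have [P PC BP] := sub_max_elements BA.
  apply/bigcupP; exists P => //; by apply: (subsetP BP).
have triv : trivIset C.
  apply/trivIsetP => Y Z YC ZC; apply: contraR => /pred0Pn[s /= /andP[sY sZ]].
  have YN := subsetP CN _ YC; have ZN := subsetP CN _ ZC.
  have [YZ|ZY] := nested_laminar nN YN ZN sY sZ.
    by move: (YC); rewrite inE => /andP[_ /'forall_implyP/(_ Z (CA _ ZC))];
      rewrite YZ eq_sym.
  by move: (ZC); rewrite inE => /andP[_ /'forall_implyP/(_ Y (CA _ YC))]; rewrite ZY.
have covB : cover C \in BB.
  rewrite -(setUidPr XC); apply: building_setU_cover => //.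
    by apply/subsetP => B /(subsetP CN) /NB.
  move=> Y /CA; rewrite inE => /and3P[_ _ /set0Pn[s]].
  by rewrite inE => /andP[sX sY]; exists s.
have : ~~ (1 < #|C|)%N.
  by apply/negP => C2; move: (disj C); rewrite CN C2 triv covB.
have [s sX] := building_nonempty XB.
have /bigcupP[B BC sB] := subsetP XC s sX.
rewrite -leqNgt leq_eqVlt ltnS leqn0 cards_eq0 => /orP[/cards1P[D CD]|/eqP C0]; last first.
  by move: BC; rewrite C0 inE.
have := CA D; rewrite CD set11 => /(_ isT); rewrite inE => /and3P[_ /negP + _]; apply.
by move: XC; rewrite CD /cover big_set1.
Qed.

(** The members of N containing X share the points of X, so they form a chain; it is
non-empty because N contains the maximal members of the building set. *)
Lemma nested_hull N X : boolean_nested_set BB N -> X \in BB ->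
  exists P, [/\ P \in N, X \subset P & forall B, B \in N -> X \subset B -> P \subset B].
Proof.
move=> nN XB; have [_ /subsetP kN _ _] := and4P nN.
have [K /kN KN XK] := sub_max_elements XB.
have K0 : [pred K in N | X \subset K] K by rewrite /= KN.
case: (arg_minnP (fun P => #|P|) K0) => P /andP[PN XP] Pmin.
exists P; split=> // B BN XB'; have [s sX] := building_nonempty XB.
have [//|BP] := nested_laminar nN PN BN (subsetP XP _ sX) (subsetP XB' _ sX).
by have /eqP<- : B == P by rewrite eqEcard BP; apply: Pmin; rewrite /= BN.
Qed.

Lemma bottom_hull N X P : X \subset P ->
  (forall B, B \in N -> X \subset B -> P \subset B) -> bottom N X \subset bottom N P.
Proof.
move=> XP Pmin; apply/subsetP => s /bottomP[sX sN]; apply/bottomP.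
by split=> [|B BN sB]; [apply: (subsetP XP) | apply: Pmin => //; apply: sN].
Qed.

(** Faces omit the maximal members of the building set, which are disjoint from the
face and can be put back. *)
Lemma nested_complexP N : reflect
  (N \subset BB :\: boolean_kappa BB /\ boolean_nested_set BB (N :|: boolean_kappa BB))
  (N \in boolean_nested_complex BB).
Proof.
apply: (iffP imsetP) => [[M]|[]].
  rewrite inE => nM ->; have [MB kM _ _] := and4P nM.
  suff -> : M :\: boolean_kappa BB :|: boolean_kappa BB = M by rewrite setSD.
  by rewrite -{2}(setIidPr kM) setUC setID.
rewrite subsetD => /andP[NB Nk] nN; exists (N :|: boolean_kappa BB); first by rewrite inE.
by rewrite setDUl setDv setU0; apply/esym/setDidPl.
Qed.

Lemma nested_complex_sub A N :
  N \in boolean_nested_complex BB -> A \subset N -> A \in boolean_nested_complex BB.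
Proof.
case/nested_complexP => NB /and4P[sub _ /'forall_implyP lam /forallP disj] AN.
have AkN : A :|: boolean_kappa BB \subset N :|: boolean_kappa BB by rewrite setSU.
apply/nested_complexP; split; first exact: subset_trans NB.
apply/and4P; split; [exact: subset_trans sub | exact: subsetUr | |].
  apply/'forall_implyP => X /(subsetP AkN) /lam /'forall_implyP XN.
  by apply/'forall_implyP => Y /(subsetP AkN) /XN.
apply/forallP => C; apply/implyP => /andP[CA C2].
by move/implyP: (disj C); rewrite (subset_trans CA AkN); apply.
Qed.

(** Maximal members of the building set that meet X contain it, hence impose no
condition; this lets [bottom] be used on faces of the complex and on nested sets
alike. *)
Lemma bottom_kappa N X : X \in BB -> bottom (N :|: boolean_kappa BB) X = bottom N X.
Proof.
move=> XB; apply/eqP; rewrite eqEsubset bottom_anti ?subsetUl //=.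
apply/subsetP => s /bottomP[sX sN]; apply/bottomP; split=> // B.
by rewrite inE => /orP[/sN|Bk sB] //; apply: (meets_boolean_kappa Bk XB sB sX).
Qed.

Lemma bottom_neq0 N X :
  N \in boolean_nested_complex BB -> X \in BB -> exists s, s \in bottom N X.
Proof.
case/nested_complexP => _ nN XB; rewrite -bottom_kappa //; exact: bottom_nonempty.
Qed.

(** Take for X the smallest member P of N or of the maximal elements that contains B.
A point of [bottom N B] is also in [bottom N P], since containing B and containing
P are the same for members of N, and P is not contained in B because P is
different from B. *)
Lemma bottom_separates N B : N \in boolean_nested_complex BB ->
  B \in BB :\: boolean_kappa BB -> B \notin N ->
  exists X s, [/\ X \in BB, s \in bottom N X, s \in B & ~~ (X \subset B)].
Proof.
case/nested_complexP => NB nN; rewrite inE => /andP[Bk BB'] BN.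
have [P [PN BP Pmin]] := nested_hull nN BB'.
have [s sB] := bottom_nonempty nN BB'.
have PB : P \in BB by case/and4P: nN => /subsetP/(_ P PN).
exists P, s; split=> //; last 1 first.
- apply: contra BN => PB'.
  have -> : B = P by apply/eqP; rewrite eqEsubset BP.
  move: PN; rewrite inE => /orP[//|Pk].
  by case/negP: Bk; have -> : B = P by apply/eqP; rewrite eqEsubset BP.
- by rewrite -bottom_kappa //; apply: subsetP sB; apply: bottom_hull.
- by case/bottomP: sB.
Qed.

(** A member B of N outside M would be separated by some X and s as in
[bottom_separates]; but s in [bottom N X] lies in B, so X would be contained in B. *)
Lemma bottom_inj M N :
  M \in boolean_nested_complex BB -> N \in boolean_nested_complex BB ->
  (forall X, X \in BB -> bottom M X \subset bottom N X) -> N \subset M.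
Proof.
move=> MD /nested_complexP[/subsetP NB _] MN; apply/subsetP => B BN.
apply: contraT => BM.
have [X [s [XB /(subsetP (MN X XB)) /bottomP[_ sN] sB]]] :=
  bottom_separates MD (NB B BN) BM.
by rewrite sN.
Qed.

End Bottom.

(** * Minimum loci of functionals on building sets *)

Section Argmin.
Context {T : finType} {R : realType}.
Variable BB : {set {set T}}.
Hypothesis BBbuild : boolean_building_set BB.
Implicit Types (X Y P : {set T}) (A M N C : {set {set T}}) (c : {ffun T -> R^o}).

Definition argmin X c : {set T} :=
  [set s in X | [forall r in X, (c s : R) <= c r]].

Lemma argminP X c s :
  reflect (s \in X /\ forall r, r \in X -> (c s : R) <= c r) (s \in argmin X c).
Proof.
rewrite inE; apply: (iffP andP) => -[sX]; first by move=> /'forall_implyP H.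
by move=> H; split=> //; apply/'forall_implyP.
Qed.

Lemma argmin_eq X c s r : s \in argmin X c -> r \in argmin X c -> c s = c r.
Proof.
case/argminP => sX smin /argminP[rX rmin].
by apply/eqP; rewrite eq_le (smin r rX) rmin.
Qed.

Lemma argmin_neq0 X c : X \in BB -> exists s, s \in argmin X c.
Proof.
move=> /(building_nonempty BBbuild)[s0 s0X].
case: (arg_minP (P := [pred s in X]) (fun s => c s : R) s0X) => s sX smin.
by exists s; apply/argminP.
Qed.

Definition minval X c : R := if [pick s in argmin X c] is Some s then c s else 0.

Lemma argmin_minval X c s : s \in argmin X c -> minval X c = c s.
Proof.
move=> sX; rewrite /minval; case: pickP => [r rX|/(_ s)]; last by rewrite sX.
exact: argmin_eq rX sX.
Qed.

Lemma minval_le X c s : s \in X -> X \in BB -> minval X c <= c s.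
Proof.
move=> sX /(argmin_neq0 c)[r rX]; rewrite (argmin_minval rX).
by case/argminP: rX => _; apply.
Qed.

Lemma minval_argmin X c s : s \in X -> X \in BB -> (s \in argmin X c) = (minval X c == c s).
Proof.
move=> sX XB; apply/idP/eqP => [/argmin_minval //|cs].
by apply/argminP; split=> // r rX; rewrite -cs minval_le.
Qed.

Lemma minval_anti X Y c : X \in BB -> Y \in BB -> X \subset Y -> minval Y c <= minval X c.
Proof.
move=> /(argmin_neq0 c)[s sX] YB XY; rewrite (argmin_minval sX).
by apply: minval_le => //; apply: (subsetP XY); case/argminP: sX.
Qed.

Lemma indic_vecE (X : {set T}) s : (indic_vec R X s : R) = (s \in X)%:R.
Proof.
rewrite /indic_vec sum_ffunE; have [sX|sX] := boolP (s \in X).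
  rewrite (bigD1 s) //= big1 ?addr0 ?ffunE ?eqxx // => r /andP[_ rs].
  by rewrite ffunE eq_sym (negPf rs).
rewrite big1 // => r rX; rewrite ffunE; case: eqP => // sr.
by rewrite sr rX in sX.
Qed.

Lemma sum_indic_vecE N (t : {set T} -> R) s :
  ((\sum_(B in N) t B *: indic_vec R B : {ffun T -> R^o}) s : R)
  = \sum_(B in N) t B * (s \in B)%:R.
Proof.
by rewrite sum_ffunE; apply: eq_bigr => B _; rewrite ffunE -indic_vecE.
Qed.

(** At a point s of X, the members of N containing X contribute the same total
whatever s is, and the others contribute a non-negative excess. The excess
vanishes exactly on the set [bottom A X], where A is the support of t, and it does
vanish somewhere by [bottom_neq0]. *)
Lemma argmin_sum_indic_vec N (t : {set T} -> R) X :
  N \in boolean_nested_complex BB -> (forall B, B \in N -> 0 <= t B) -> X \in BB ->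
  argmin X (\sum_(B in N) t B *: indic_vec R B) = bottom [set B in N | 0 < t B] X.
Proof.
move=> ND t0 XB; set c := \sum_(B in N) _; set A := [set B in N | _].
have AD : A \in boolean_nested_complex BB.
  by apply: nested_complex_sub ND _; apply/subsetP => B; rewrite inE => /andP[].
pose m : R := \sum_(B in N) t B * (X \subset B)%:R.
have excess s : s \in X -> forall B, B \in N ->
    0 <= t B * (s \in B)%:R - t B * (X \subset B)%:R.
  move=> sX B BN; rewrite -mulrBr mulr_ge0 ?t0 //.
  by have [/subsetP->|_] := boolP (X \subset B); rewrite ?subrr ?subr0.
have cm s : (c s : R) - m = \sum_(B in N) (t B * (s \in B)%:R - t B * (X \subset B)%:R).
  by rewrite sumrB -sum_indic_vecE.
have mc s : s \in X -> m <= c s.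
  by move=> sX; rewrite -subr_ge0 cm sumr_ge0 // => B; exact: excess.
have bE s : s \in X -> (s \in bottom A X) = ((c s : R) == m).
  move=> sX; rewrite -subr_eq0 cm; apply/bottomP/eqP => [[_ sA]|].
    apply: big1 => B BN; have [tB|tB] := ltP 0 (t B).
      have [sB|sB] := boolP (s \in B); first by rewrite (sA B) ?subrr // inE BN.
      suff /negPf-> : ~~ (X \subset B) by rewrite subrr.
      by apply: contra sB => /subsetP; apply.
    have -> : t B = 0 by apply/eqP; rewrite eq_le tB t0.
    by rewrite !mul0r subrr.
  move=> /(psumr_eq0P (excess s sX)) z; split=> // B; rewrite inE => /andP[BN tB] sB.
  move: (z B BN); rewrite sB -mulrBr => /eqP; rewrite mulf_eq0 gt_eqF //=.
  by case: (X \subset B); rewrite // subr0 oner_eq0.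
have [s0 s0b] := bottom_neq0 BBbuild AD XB.
have s0X : s0 \in X by case/bottomP: s0b.
have c0 : (c s0 : R) = m by apply/eqP; rewrite -bE.
apply/setP => s; apply/argminP/idP => [[sX smin]|sb].
  by rewrite bE // eq_le mc // andbT -c0 smin.
have sX : s \in X by case/bottomP: sb.
split=> // r rX; have /eqP-> : (c s : R) == m by rewrite -bE.
exact: mc.
Qed.

(** Let Nk be N together with the maximal members of the building set. The minimum of
c over X is the minimum over the smallest member P of Nk containing X, because
[bottom Nk X] is contained in [bottom Nk P]. The minimum increases weakly when
going down in Nk, and A collects the members of N at which it increases strictly
from everything above. These are the members that receive a positive coefficient
when c is expanded in the vectors e_B. *)
Lemma argmin_coarsening N c : N \in boolean_nested_complex BB ->
  (forall X, X \in BB -> bottom N X \subset argmin X c) ->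
  exists2 A : {set {set T}}, A \subset N & forall X, X \in BB -> argmin X c = bottom A X.
Proof.
move=> ND Nc; have /nested_complexP[NB nN] := ND; set Nk := N :|: _ in nN.
have NkB Q : Q \in Nk -> Q \in BB by case/and4P: nN => /subsetP + _ _ _; apply.
have hullval X P s : X \in BB -> P \in Nk -> s \in bottom Nk X -> X \subset P ->
    (forall B, B \in Nk -> X \subset B -> P \subset B) -> minval P c = c s.
  move=> XB PN sX XP Pmin; apply: argmin_minval.
  apply: (subsetP (Nc P (NkB P PN))); rewrite -(bottom_kappa BBbuild) ?NkB //.
  by apply: subsetP sX; apply: bottom_hull.
pose A := [set B in N | [forall Q in Nk, (B \proper Q) ==> (minval Q c < minval B c)]].
exists A; first by apply/subsetP => B; rewrite inE => /andP[].
move=> X XB; have [P [PN XP Pmin]] := nested_hull BBbuild nN XB.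
have [s0 s0b] := bottom_nonempty BBbuild nN XB.
have PX : minval P c = minval X c.
  rewrite (hullval X P s0) //; apply/esym/argmin_minval.
  by apply: (subsetP (Nc X XB)); rewrite -(bottom_kappa BBbuild).
apply/setP => s; apply/idP/bottomP => [sX|[sX sA]].
  have sX' : s \in X by case/argminP: sX.
  split=> // B; rewrite inE => /andP[BN /'forall_implyP Bdrop] sB.
  have BNk : B \in Nk by rewrite inE BN.
  have [PB|BP] := nested_laminar nN PN BNk (subsetP XP _ sX') sB.
    exact: subset_trans XP PB.
  have := Bdrop P PN; rewrite properE BP /=.
  have [PB _|_ /=] := boolP (P \subset B); first exact: subset_trans XP PB.
  by rewrite ltNge PX (argmin_minval sX) minval_le ?NkB.
rewrite minval_argmin // eq_le minval_le //= leNgt; apply/negP => cs.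
have s1B : [set s] \in BB by case/and3P: BBbuild => _ /forallP/(_ s).
have [B0 [B0N sB0 B0min]] := nested_hull BBbuild nN s1B.
have B0c : minval B0 c = c s.
  apply: (hullval [set s]) => //; apply/bottomP; rewrite set11.
  by split=> // B _ sB; rewrite sub1set.
(* c s exceeds the minimum over X; the largest member of Nk through s whose
   minimum still exceeds it belongs to A, but it cannot contain X *)
have B0P : [pred B in Nk | (s \in B) && (minval X c < minval B c)] B0.
  by rewrite /= B0N -sub1set sB0 B0c.
case: (arg_maxnP (fun B : {set T} => #|B|) B0P) => B /and3P[BNk sB Bc] Bmax.
have PB : ~~ (P \subset B).
  apply/negP => /(minval_anti c (NkB P PN) (NkB B BNk)).
  by rewrite PX leNgt Bc.
have [/idPn//|BP] := nested_laminar nN PN BNk (subsetP XP _ sX) sB.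
have BN : B \in N.
  move: BNk; rewrite inE => /orP[//|]; rewrite inE => /andP[_ /'forall_implyP].
  move=> /(_ P (NkB P PN)); rewrite BP /= => /eqP PB'.
  by rewrite PB' subxx in PB.
have BA : B \in A.
  rewrite inE BN; apply/'forall_implyP => Q QN; apply/implyP => BQ.
  rewrite ltNge; apply/negP => Qc.
  have := proper_card BQ; rewrite ltnNge => /negP; apply; apply: Bmax.
  by rewrite /= QN (subsetP (proper_sub BQ)) //= (lt_le_trans Bc).
by case/negP: PB; apply: Pmin => //; apply: sA.
Qed.

End Argmin.

(** * Cones *)

Section Dot.
Context {R : realType} {T : finType}.
Local Notation V := {ffun T -> R^o}.
Implicit Types (c x : V).

Lemma dotDr c x y : dot c (x + y) = dot c x + dot c y.
Proof.
rewrite /dot -big_split; apply: eq_bigr => s _; rewrite ffunE; exact: mulrDr.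
Qed.

Lemma dotZr c a x : dot c (a *: x) = a * dot c x.
Proof.
rewrite /dot mulr_sumr; apply: eq_bigr => s _; rewrite ffunE; exact: mulrCA.
Qed.

Lemma dot0r c : dot c 0 = 0.
Proof. by rewrite /dot big1 // => s _; rewrite ffunE mulr0. Qed.

Lemma dotC c x : dot c x = dot x c.
Proof. by apply: eq_bigr => s _; rewrite mulrC. Qed.

Lemma dotNl c x : dot (- c) x = - dot c x.
Proof. by rewrite -scaleN1r dotC dotZr mulN1r dotC. Qed.

Lemma dot_sumr (I : finType) (A : {set I}) c (v : I -> V) :
  dot c (\sum_(i in A) v i) = \sum_(i in A) dot c (v i).
Proof. exact: (big_morph _ (dotDr c) (dot0r c)). Qed.

Lemma dot_suml (I : finType) (A : {set I}) (v : I -> V) x :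
  dot (\sum_(i in A) v i) x = \sum_(i in A) dot (v i) x.
Proof. by rewrite dotC dot_sumr; apply: eq_bigr => i _; rewrite dotC. Qed.

Lemma dot_basis_vec c s : dot c (basis_vec R s) = c s.
Proof.
rewrite /dot (bigD1 s) //= big1 ?addr0 ?ffunE ?eqxx ?mulr1 // => r rs.
by rewrite ffunE (negPf rs) mulr0.
Qed.

End Dot.

Section Cones.
Context {R : realType} {T I : finType}.
Local Notation V := {ffun T -> R^o}.
Variable v : I -> V.
Implicit Types A N : {set I}.

Lemma cone_generator N i : i \in N -> cone N v (v i).
Proof.
move=> iN; exists (fun j => (j == i)%:R) => [j _|]; first exact: ler0n.
rewrite (bigD1 i) //= eqxx scale1r big1 ?addr0 // => j /andP[_ /negPf->].
exact: scale0r.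
Qed.

Lemma sub_cone A N : A \subset N -> (cone A v `<=` cone N v)%classic.
Proof.
move=> AN x [t t0 ->]; exists (fun i => if i \in A then t i else 0) => [i _|].
  by case: ifP => // /t0.
rewrite [RHS](big_setID A) /= (setIidPr AN) [X in _ + X]big1 ?addr0.
  by apply: eq_bigr => i ->.
by move=> i; rewrite inE => /andP[/negPf-> _]; rewrite scale0r.
Qed.

(** Generators with zero coefficient can be discarded. *)
Lemma cone_support A N (t : I -> R) :
  (forall i, i \in N -> 0 <= t i) -> (forall i, i \in N -> 0 < t i -> i \in A) ->
  cone A v (\sum_(i in N) t i *: v i).
Proof.
move=> t0 tA; apply: (@sub_cone (A :&: N)); first exact: subsetIl.
exists t => [i|]; first by rewrite inE => /andP[_ /t0].
rewrite (big_setID A) /= setIC [X in _ + X]big1 ?addr0 // => i.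
rewrite inE => /andP[iA iN]; have [/(tA i iN)|ti] := ltP 0 (t i).
  by rewrite (negPf iA).
suff -> : t i = 0 by rewrite scale0r.
by apply/eqP; rewrite eq_le ti t0.
Qed.

Lemma cone_faceE N c : (forall i, i \in N -> 0 <= dot c (v i)) ->
  ([set x | cone N v x /\ dot c x = 0] = cone [set i in N | dot c (v i) == 0] v)%classic.
Proof.
move=> c0; rewrite predeqE => x; split.
  case=> -[t t0 ->]; rewrite dot_sumr.
  under eq_bigr do rewrite dotZr.
  move=> /psumr_eq0P-z; apply: cone_support => // i iN ti; rewrite inE iN /=.
  have := z (fun j jN => mulr_ge0 (t0 j jN) (c0 j jN)) i iN.
  by move/eqP; rewrite mulf_eq0 gt_eqF.
move=> xA; split.
  by apply: sub_cone xA; apply/subsetP => i; rewrite inE => /andP[].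
case: xA => t _ ->; rewrite dot_sumr big1 // => i; rewrite inE => /andP[_ /eqP ci].
by rewrite dotZr ci mulr0.
Qed.

Lemma cone_dot_ge0 N c x : (forall i, i \in N -> 0 <= dot c (v i)) ->
  cone N v x -> 0 <= dot c x.
Proof.
move=> c0 [t t0 ->]; rewrite dot_sumr sumr_ge0 // => i iN.
by rewrite dotZr mulr_ge0 ?t0 ?c0.
Qed.

Lemma cone_polyhedral N : polyhedral_cone (cone N v).
Proof.
exists #|N|, (v \o enum_val); rewrite predeqE => x; split.
  case=> t t0 ->; exists (t \o enum_val) => [i _|]; first exact/t0/enum_valP.
  by rewrite big_enum_val; apply: eq_bigl => i; rewrite inE.
case=> t t0 ->; exists (fun i => \sum_(j < #|N| | enum_val j == i) t j) => [i _|].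
  by apply: sumr_ge0 => j _; apply: t0; rewrite inE.
rewrite [RHS]big_enum_val; apply: eq_big => [i|j _]; first by rewrite inE.
by rewrite (big_pred1 j) // => k; exact: (inj_eq enum_val_inj).
Qed.

End Cones.

(** * The nested fan *)

Section NestedFan.
Context {R : realType} {T : finType}.
Variable BB : {set {set T}}.
Hypothesis BBbuild : boolean_building_set BB.
Local Notation V := {ffun T -> R^o}.
Local Notation D := (boolean_nested_complex BB).
Local Notation e_ := (@indic_vec R T).
Implicit Types (X Y P : {set T}) (A M N : {set {set T}}) (c : V).

Lemma dot_basisB_indic (s q : T) X :
  dot (basis_vec R s - basis_vec R q) (e_ X) = (s \in X)%:R - (q \in X)%:R.
Proof. by rewrite dotC dotDr -scaleN1r dotZr mulN1r !dot_basis_vec !indic_vecE. Qed.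

(** For each C in N outside A, [bottom_separates] gives X and a point s of C in
[bottom A X] with X not contained in C; take any q in [bottom N X]. The functional
x_s - x_q is non-negative on e_B for B in N, since B contains X as soon as it
contains q; it vanishes for B in A, since then s in B also forces X into B; and it
equals 1 on e_C. The sum of these functionals over C cuts out A. *)
Lemma nested_cone_functional A N : N \in D -> A \subset N ->
  exists c : V, (forall B, B \in N -> 0 <= dot c (e_ B)) /\
    [set B in N | dot c (e_ B) == 0] = A.
Proof.
move=> ND AN; have AD := nested_complex_sub ND AN.
have /nested_complexP[/subsetP NB _] := ND.
have sep C : exists c : V, C \in N :\: A ->
    [/\ forall B, B \in N -> 0 <= dot c (e_ B),
        forall B, B \in A -> dot c (e_ B) = 0 &
        dot c (e_ C) = 1].
  have [|?] := boolP (C \in N :\: A); last by exists 0.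
  rewrite inE => /andP[CA CN].
  have [X [s [XB /bottomP[sX sA] sC XC]]] := bottom_separates BBbuild AD (NB C CN) CA.
  have [q /bottomP[qX qN]] := bottom_neq0 BBbuild ND XB.
  exists (basis_vec R s - basis_vec R q) => _; split=> [B BN|B BA|]; rewrite dot_basisB_indic.
  - have [qB|_] := boolP (q \in B); last by rewrite subr0 ler0n.
    by rewrite (subsetP (qN B BN qB) _ sX) subrr.
  - have BN := subsetP AN _ BA.
    suff -> : (s \in B) = (q \in B) by rewrite subrr.
    apply/idP/idP => [/(sA B BA)/subsetP|/(qN B BN)/subsetP]; exact.
  - rewrite sC; suff /negPf-> : q \notin C by rewrite subr0.
    by apply: contra XC => /(qN C CN).
have [f fP] := choice sep; exists (\sum_(C in N :\: A) f C).
have ge0 B : B \in N -> forall C, C \in N :\: A -> 0 <= dot (f C) (e_ B).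
  by move=> BN C /fP[+ _ _]; apply.
split=> [B BN|]; first by rewrite dot_suml sumr_ge0 // => C; apply: ge0.
apply/setP => B; rewrite inE; apply/andP/idP => [[BN]|BA]; last first.
  split; first exact: subsetP BA.
  by rewrite dot_suml big1 // => C /fP[_ + _]; apply.
rewrite dot_suml => /eqP/(psumr_eq0P (ge0 B BN)) z; apply: contraT => BA.
have BNA : B \in N :\: A by rewrite inE BA.
by have [_ _ /eqP] := fP B BNA; rewrite z // eq_sym oner_eq0.
Qed.

(** Expand the same vector in both cones and compare the loci where it is minimal:
by [argmin_sum_indic_vec] they are the sets [bottom M X] on one side and those of
the support of the other expansion, so the two supports agree. *)
Lemma cone_sum_sub M N (t : {set T} -> R) :
  M \in D -> N \in D -> (forall B, B \in M -> 0 < t B) ->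
  cone N e_ (\sum_(B in M) t B *: e_ B) -> M \subset N.
Proof.
move=> MD ND t0 [u u0 tu].
have uD : [set B in N | 0 < u B] \in D.
  by apply: nested_complex_sub ND _; apply/subsetP => B; rewrite inE => /andP[].
suff /subsetP MA : M \subset [set B in N | 0 < u B].
  by apply/subsetP => B /MA; rewrite inE => /andP[].
apply: (bottom_inj BBbuild) => // X XB.
rewrite -(argmin_sum_indic_vec BBbuild ND u0 XB) -tu.
rewrite (argmin_sum_indic_vec BBbuild MD _ XB); last by move=> B /t0/ltW.
by apply: bottom_anti; apply/subsetP => B BM; rewrite inE BM t0.
Qed.

Lemma nested_cone_sub M N : M \in D -> N \in D ->
  (cone M e_ `<=` cone N e_)%classic <-> M \subset N.
Proof.
move=> MD ND; split=> [MN|]; last exact: sub_cone.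
apply: (@cone_sum_sub M N (fun=> 1)) => //; apply: MN.
by exists (fun=> 1).
Qed.

Lemma nested_coneI M N : M \in D -> N \in D ->
  (cone M e_ `&` cone N e_)%classic = cone (M :&: N) e_.
Proof.
move=> MD ND; rewrite predeqE => x; split=> [[[t t0 ->]]|xMN]; last first.
  by split; apply: sub_cone xMN; rewrite ?subsetIl ?subsetIr.
pose A := [set B in M | 0 < t B].
have AM : A \subset M by apply/subsetP => B; rewrite inE => /andP[].
have -> : \sum_(B in M) t B *: e_ B = \sum_(B in A) t B *: e_ B.
  rewrite (big_setID A) /= (setIidPr AM) [X in _ + X]big1 ?addr0 // => B.
  rewrite !inE => /andP[+ BM]; rewrite BM /= -leNgt => tB.
  suff -> : t B = 0 by rewrite scale0r.
  by apply/eqP; rewrite eq_le tB t0.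
move=> /(@cone_sum_sub A N) AN; exists (fun B => if B \in A then t B else 0).
  by move=> B; rewrite inE => /andP[BM _]; case: ifP => // _; exact: t0.
have {}AN : A \subset N.
  by apply: AN => //; [exact: nested_complex_sub AM | move=> B; rewrite inE => /andP[]].
rewrite [RHS](big_setID A) /= (setIidPr _) ?subsetI ?AM // [X in _ + X]big1 ?addr0.
  by apply: eq_bigr => B ->.
by move=> B; rewrite inE => /andP[/negPf-> _]; rewrite scale0r.
Qed.

Lemma nested_subfan (Delta : {set {set {set T}}}) :
  Delta \subset D -> (forall A N, N \in Delta -> A \subset N -> A \in Delta) ->
  subfan [set C | exists2 N, N \in Delta & C = cone N e_]%classic
    (@nested_fan R T BB).
Proof.
move=> /subsetP DD Dsub.
have faces A N : N \in Delta -> A \subset N ->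
    cone_face (cone N e_) (cone A e_).
  move=> ND AN; have [c [c0 cA]] := nested_cone_functional (DD N ND) AN.
  exists c; first by move=> x; exact: cone_dot_ge0.
  by rewrite cone_faceE // cA.
split; last by move=> C [N /DD ND ->]; exists N.
split.
- apply: (@sub_finite_set _ _ [set cone N e_ | N in [set` Delta]]%classic).
    by move=> C [N ND ->]; exists N.
  exact/finite_image/finite_finset.
- by move=> C [N _ ->]; exact: cone_polyhedral.
- move=> C F [N ND ->] [c c0 ->].
  rewrite cone_faceE => [|B BN]; last exact/c0/cone_generator.
  exists [set B in N | dot c (e_ B) == 0] => //.
  by apply: Dsub ND _; apply/subsetP => B; rewrite inE => /andP[].
- move=> C1 C2 [M MD ->] [N ND ->]; rewrite nested_coneI ?DD //.
  by split; apply: faces; rewrite ?subsetIl ?subsetIr.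
Qed.

End NestedFan.

(** * Faces of the nestohedron *)

Section Nestohedron.
Context {R : realType} {T : finType}.
Variable BB : {set {set T}}.
Hypothesis BBbuild : boolean_building_set BB.
Variable lam : {set T} -> R.
Hypothesis lam_gt0 : forall X, X \in BB -> (2 <= #|X|)%N -> 0 < lam X.
Local Notation V := {ffun T -> R^o}.
Local Notation D := (boolean_nested_complex BB).
Local Notation e_ := (@indic_vec R T).
Local Notation Q := (nestohedron BB lam).
Implicit Types (X Y : {set T}) (A M N : {set {set T}}) (c : V).

Definition convex_weights X (t : T -> R) : Prop :=
  (forall s, s \in X -> 0 <= t s) /\ \sum_(s in X) t s = 1.

(** A choice of one point in each of the simplices of the Minkowski sum. *)
Definition nest_point (t : {set T} -> T -> R) : V :=
  \sum_(X in BB) lam X *: \sum_(s in X) t X s *: basis_vec R s.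

Lemma nestohedronP x : nestohedron BB lam x <->
  exists2 t, (forall X, X \in BB -> convex_weights X (t X)) & x = nest_point t.
Proof.
split=> [[p pP ->]|[t tP ->]]; last first.
  exists (fun X => lam X *: \sum_(s in X) t X s *: basis_vec R s) => // X XB.
  by have [t0 t1] := tP X XB; exists (\sum_(s in X) t X s *: basis_vec R s) => //; exists (t X).
have /choice[t tP] : forall X, exists t : T -> R, X \in BB ->
    convex_weights X t /\ p X = lam X *: \sum_(s in X) t s *: basis_vec R s.
  move=> X; have [XB|_] := boolP (X \in BB); last by exists (fun=> 0).
  by have [y [t [t0 t1 ->]] <-] := pP X XB; exists t.
exists t; first by move=> X /tP[].
by apply: eq_bigr => X /tP[].
Qed.

Lemma dot_nest_point c t :
  dot c (nest_point t) = \sum_(X in BB) lam X * \sum_(s in X) t X s * (c s : R).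
Proof.
rewrite dot_sumr; apply: eq_bigr => X _; rewrite dotZr dot_sumr.
by congr (_ * _); apply: eq_bigr => s _; rewrite dotZr dot_basis_vec.
Qed.

Lemma convex_weights_excess X t c : convex_weights X t ->
  \sum_(s in X) t s * (c s : R) - minval X c = \sum_(s in X) t s * (c s - minval X c).
Proof.
case=> _ t1; rewrite -[X in _ - X]mul1r -t1 mulr_suml -sumrB.
by apply: eq_bigr => s _; rewrite mulrBr.
Qed.

Lemma minval_le_average X t c : X \in BB -> convex_weights X t ->
  minval X c <= \sum_(s in X) t s * (c s : R).
Proof.
move=> XB tX; rewrite -subr_ge0 convex_weights_excess // sumr_ge0 // => s sX.
by rewrite mulr_ge0 ?subr_ge0 ?(minval_le BBbuild) //; case: tX => + _; apply.
Qed.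

(** The average of c exceeds its minimum by a non-negative combination of the
non-negative numbers c s - minval X c. *)
Lemma average_eq_minval X t c : X \in BB -> convex_weights X t ->
  \sum_(s in X) t s * (c s : R) = minval X c <->
  forall s, s \in X -> 0 < t s -> s \in argmin X c.
Proof.
move=> XB tX; have [t0 _] := tX.
have e0 s : s \in X -> 0 <= t s * ((c s : R) - minval X c).
  by move=> sX; rewrite mulr_ge0 ?t0 // subr_ge0 (minval_le BBbuild).
split=> [/eqP|tc].
  rewrite -subr_eq0 convex_weights_excess // => /eqP/(psumr_eq0P e0) z s sX ts.
  rewrite (minval_argmin BBbuild) // eq_sym -subr_eq0.
  by have /eqP := z s sX; rewrite mulf_eq0 gt_eqF.
apply/eqP; rewrite -subr_eq0 convex_weights_excess //; apply/eqP/big1 => s sX.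
have [/(tc s sX)/argmin_minval->|ts] := ltP 0 (t s); first by rewrite subrr mulr0.
by have -> : t s = 0; [apply/eqP; rewrite eq_le ts t0 | rewrite mul0r].
Qed.

(** A summand indexed by a singleton is a point: its only weight sits on the minimum
locus, whatever the sign of its coefficient. *)
Lemma argmin_card1 X c s : (#|X| <= 1)%N -> s \in X -> s \in argmin X c.
Proof.
move=> /card_le1P X1 sX; apply/argminP; split=> // r rX.
by have := X1 s sX r; rewrite rX inE => /esym/eqP->.
Qed.

Definition support_value c : R := \sum_(X in BB) lam X * minval X c.

Lemma nest_term_ge0 X t c : X \in BB -> convex_weights X t ->
  0 <= lam X * (\sum_(s in X) t s * (c s : R) - minval X c).
Proof.
move=> XB tX; have [X2|X1] := ltnP 1 #|X|.
  by rewrite mulr_ge0 ?(ltW (lam_gt0 XB X2)) // subr_ge0 minval_le_average.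
suff -> : \sum_(s in X) t s * (c s : R) = minval X c by rewrite subrr mulr0.
by apply/(average_eq_minval c XB tX) => s sX _; exact: argmin_card1.
Qed.

Lemma nest_point_excess c t : dot c (nest_point t) - support_value c =
  \sum_(X in BB) lam X * (\sum_(s in X) t X s * (c s : R) - minval X c).
Proof. by rewrite dot_nest_point -sumrB; apply: eq_bigr => X _; rewrite mulrBr. Qed.

Lemma support_value_le c x : Q x -> support_value c <= dot c x.
Proof.
case/nestohedronP => t tP ->; rewrite -subr_ge0 nest_point_excess sumr_ge0 // => X XB.
exact/nest_term_ge0/tP.
Qed.

(** A linear functional is minimal on a Minkowski sum exactly when it is minimal on
every summand. *)
Lemma nest_point_optimal c t : (forall X, X \in BB -> convex_weights X (t X)) ->
  dot c (nest_point t) = support_value c <->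
  forall X s, X \in BB -> s \in X -> 0 < t X s -> s \in argmin X c.
Proof.
move=> tP; split=> [/eqP|tc].
  rewrite -subr_eq0 nest_point_excess => /eqP/psumr_eq0P-z X s XB.
  have [X2|X1 sX _] := ltnP 1 #|X|; last exact: argmin_card1.
  move: s; apply/(average_eq_minval c XB (tP X XB))/eqP; rewrite -subr_eq0.
  have /eqP := z (fun Y YB => nest_term_ge0 c YB (tP Y YB)) X XB.
  by rewrite mulf_eq0 gt_eqF // lam_gt0.
apply/eqP; rewrite -subr_eq0 nest_point_excess big1 // => X XB.
suff -> : \sum_(s in X) t X s * (c s : R) = minval X c by rewrite subrr mulr0.
by apply/(average_eq_minval c XB (tP X XB)) => s sX; exact: tc.
Qed.

(** The barycenter of the locus: all of its points get positive weight, so the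
corresponding point of the nestohedron is relatively interior in the face
minimizing c and detects inclusions between faces. *)
Definition argmin_weights c X s : R := if s \in argmin X c then #|argmin X c|%:R^-1 else 0.

Lemma argmin_weights_convex c X : X \in BB -> convex_weights X (argmin_weights c X).
Proof.
move=> XB; split=> [s _|]; rewrite /argmin_weights.
  by case: ifP => // _; rewrite invr_ge0 ler0n.
have sub : argmin X c \subset X by apply/subsetP => s /argminP[].
rewrite -big_mkcondr (eq_bigl (mem (argmin X c))) => [|s]; last first.
  by rewrite /= andb_idl // => /(subsetP sub).
rewrite sumr_const -[LHS]mulr_natl divff // pnatr_eq0 -lt0n.
by have [s sX] := argmin_neq0 BBbuild c XB; apply/card_gt0P; exists s.
Qed.

Definition min_face c : set V := [set x | Q x /\ dot c x = support_value c]%classic.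

Lemma min_face_barycenter c : min_face c (nest_point (argmin_weights c)).
Proof.
have tP X := @argmin_weights_convex c X.
split; first by apply/nestohedronP; exists (argmin_weights c).
apply/(nest_point_optimal _ tP) => X s _ _; rewrite /argmin_weights.
by case: ifP => //; rewrite ltxx.
Qed.

Lemma min_face_sub c c' : (min_face c `<=` min_face c')%classic <->
  forall X, X \in BB -> argmin X c \subset argmin X c'.
Proof.
split=> [/(_ _ (min_face_barycenter c))[_]|cc' x [Qx xc]].
  move=> /nest_point_optimal opt X XB; apply/subsetP => s sX.
  apply: opt => //; [exact: argmin_weights_convex | by case/argminP: sX |].
  rewrite /argmin_weights sX invr_gt0 ltr0n.
  by apply/card_gt0P; exists s.
split=> //; case/nestohedronP: Qx xc => t tP -> /(nest_point_optimal _ tP) tc.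
apply/(nest_point_optimal _ tP) => X s XB sX ts.
by apply: (subsetP (cc' X XB)); apply: tc.
Qed.

(** Faces are defined by maximization, hence the passage from c to -c. *)
Lemma nonempty_faceP F : nonempty_face Q F <-> exists c, F = min_face c.
Proof.
have minE c : min_face c = [set x | Q x /\ forall y, Q y -> dot c x <= dot c y]%classic.
  rewrite predeqE => x; split=> -[Qx xc]; split=> //.
    by move=> y Qy; rewrite xc support_value_le.
  apply/eqP; rewrite eq_le support_value_le // andbT.
  by have [Qy <-] := min_face_barycenter c; apply: xc.
have maxE c : [set x | Q x /\ forall y, Q y -> dot c y <= dot c x]%classic = min_face (- c).
  rewrite minE predeqE => x; split=> -[Qx xc]; split=> // y /xc.
    by rewrite !dotNl lerN2.
  by rewrite !dotNl lerN2.
split=> [[_ [c ->]]|[c ->]]; first by exists (- c).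
split; first by exists (nest_point (argmin_weights c)); exact: min_face_barycenter.
by exists (- c); rewrite maxE opprK.
Qed.

(** The vectors e_B are inner normals of the facets of the nestohedron: this is the
intersection of the facets on which e_B is minimal, for B in N. The unit
coefficients give the sum the shape of [argmin_sum_indic_vec]. *)
Definition nested_face N : set V := min_face (\sum_(B in N) 1 *: e_ B).

Lemma argmin_nested N X : N \in D -> X \in BB ->
  argmin X (\sum_(B in N) 1 *: e_ B) = bottom N X.
Proof.
move=> ND XB; rewrite (argmin_sum_indic_vec BBbuild ND _ XB) => [|B _]; last exact: ler01.
by congr bottom; apply/setP => B; rewrite inE ltr01 andbT.
Qed.

Lemma nested_face_sub M N : M \in D -> N \in D ->
  (nested_face N `<=` nested_face M)%classic <-> M \subset N.
Proof.
move=> MD ND; rewrite min_face_sub; split=> [MN|MN X XB]; last first.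
  by rewrite !argmin_nested // bottom_anti.
by apply: (bottom_inj BBbuild) => // X XB; rewrite -!argmin_nested // MN.
Qed.

(** A face containing the face of N is the minimizing face of a functional c whose
minimum loci contain those of N; by [argmin_coarsening] they are the loci of a
subset A of N, so the face is that of A. *)
Lemma nested_polar_boundary_subcomplex (Delta : {set {set {set T}}}) :
  Delta \subset D -> (forall A N, N \in Delta -> A \subset N -> A \in Delta) ->
  polar_boundary_subcomplex Q [set F | exists2 N, N \in Delta & F = nested_face N]%classic.
Proof.
move=> /subsetP DD Dsub; split=> [F [N _ ->]|F G [N ND ->]].
  by apply/nonempty_faceP; exists (\sum_(B in N) 1 *: e_ B).
move=> /nonempty_faceP[c ->] /min_face_sub Nc.
have [X XB|A AN cA] := argmin_coarsening BBbuild (c := c) (DD N ND).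
  by rewrite -argmin_nested ?DD // Nc.
have AD := Dsub A N ND AN; exists A => //.
apply/seteqP; split; apply/min_face_sub => X XB;
  by rewrite cA // argmin_nested ?DD.
Qed.

End Nestohedron.

(** * From the lattice to its atoms *)

(** Injectivity of g on the image of Delta is a consequence of reflecting the order,
by antisymmetry of inclusion. *)
Lemma realized_by_imset (I J : finType) (Delta : {set {set I}}) (f : I -> J)
    (U : Type) (g : {set J} -> U) (le : U -> U -> Prop) :
  injective f -> (forall u, le u u) ->
  (forall M N : {set I}, M \in Delta -> N \in Delta ->
     le (g (f @: M)) (g (f @: N)) <-> f @: M \subset f @: N) ->
  realized_by Delta
    [set u | exists2 N, N \in [set f @: M | M : {set I} in Delta] & u = g N]%classic le.
Proof.
move=> finj lexx gle; exists (fun N : {set I} => g (f @: N)).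
have {}gle (M N : {set I}) : M \in Delta -> N \in Delta ->
    le (g (f @: M)) (g (f @: N)) <-> M \subset N.
  move=> MD ND; rewrite gle //; split=> [/subsetP MN|]; last exact: imsetS.
  by apply/subsetP => i iM; rewrite -(mem_imset _ _ finj) MN // imset_f.
split; last by move=> M N MD ND; rewrite gle.
split=> [N ND|M N /set_mem MD /set_mem ND gMN|u [_ /imsetP[N ND ->] ->]].
- by exists (f @: N) => //; exact: imset_f.
- by apply/eqP; rewrite eqEsubset; apply/andP; split; apply/gle => //; rewrite gMN.
- by exists N.
Qed.

Section Lattice.
Context {disp : Order.disp_t} {L : finTBLatticeType disp}.
Hypothesis hL : atomic L.
Implicit Types (x y b : L) (s : atoms L).

Lemma join_atoms_below x : (\join_(s in atoms_below x) val s)%O = x.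
Proof.
have [A xA] := hL x; apply/le_anti/andP; split.
  by apply/joinsP => s; rewrite inE.
rewrite {1}xA; apply: le_joins; apply/subsetP => s sA.
by rewrite inE xA; exact: joins_sup.
Qed.

Lemma atoms_below_sub x y : (atoms_below x \subset atoms_below y) = (x <= y)%O.
Proof.
apply/idP/idP => [xy|xy].
  by rewrite -(join_atoms_below x) -(join_atoms_below y) le_joins.
by apply/subsetP => s; rewrite !inE => /le_trans; apply.
Qed.

Lemma atoms_below_inj : injective (@atoms_below _ L).
Proof. by move=> x y xy; apply: le_anti; rewrite -!atoms_below_sub xy subxx. Qed.

Lemma atom_neq0 s : val s != \bot%O.
Proof. by have /andP[] := valP s. Qed.

Lemma le_atom x s : x != \bot%O -> (x <= val s)%O -> x = val s.
Proof.
have /andP[_ /forallP/(_ x)] := valP s; rewrite lt_neqAle.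
by case: eqP => //= _ /implyP xs /negPf x0 /xs; rewrite x0.
Qed.

Lemma atom_below_exists x : x != \bot%O -> exists s, (val s <= x)%O.
Proof.
move=> x0; suff /set0Pn[s sx] : atoms_below x != set0 by exists s; rewrite inE in sx.
by apply: contraNneq x0 => xs; rewrite -(join_atoms_below x) xs big_set0.
Qed.

Lemma lattice_kappa_above (B : {set L}) b : b \in B ->
  exists2 m, m \in lattice_kappa B & (b <= m)%O.
Proof.
apply: max_elements_above => [x|y x z|x y]; [exact: lexx | exact: le_trans | exact: le_anti].
Qed.

Lemma lattice_kappa_max (B : {set L}) m b :
  m \in lattice_kappa B -> b \in B -> (m <= b)%O -> b = m.
Proof. by rewrite inE => /andP[_ /'forall_implyP mmax] /mmax/implyP + mb => /(_ mb)/eqP. Qed.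

Lemma lattice_nested_complexP (B N : {set L}) : reflect
  (N \subset B :\: lattice_kappa B /\ lattice_nested_set B (N :|: lattice_kappa B))
  (N \in lattice_nested_complex B).
Proof.
apply: (iffP imsetP) => [[M]|[]].
  rewrite inE => nM ->; have [MB kM _] := and3P nM.
  suff -> : M :\: lattice_kappa B :|: lattice_kappa B = M by rewrite setSD.
  by rewrite -{2}(setIidPr kM) setUC setID.
rewrite subsetD => /andP[NB Nk] nN; exists (N :|: lattice_kappa B); first by rewrite inE.
by rewrite setDUl setDv setU0; apply/esym/setDidPl.
Qed.

Lemma lattice_nested_complex_sub (B A N : {set L}) :
  N \in lattice_nested_complex B -> A \subset N -> A \in lattice_nested_complex B.
Proof.
case/lattice_nested_complexP => NB /and3P[sub _ /forallP disj] AN.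
have AkN : A :|: lattice_kappa B \subset N :|: lattice_kappa B by rewrite setSU.
apply/lattice_nested_complexP; split; first exact: subset_trans NB.
apply/and3P; split; [exact: subset_trans sub | exact: subsetUr | ].
apply/forallP => C; apply/implyP => /and3P[CA C2 Cinc].
by move/implyP: (disj C); rewrite (subset_trans CA (setSD _ AkN)) C2 Cinc; apply.
Qed.

Variable B : {set L}.
Hypothesis hB : lattice_building_set B.

Lemma lattice_building_neq0 b : b \in B -> b != \bot%O.
Proof. by case: hB => B0 _; apply: contraTneq => ->. Qed.

(** The atom corresponds to a non-bottom element g of the product. A non-bottom
component g m, placed alone at m, is below g, so it maps to a non-bottom element
below the atom. *)
Lemma atom_below_factor y s : (val s <= y)%O ->
  exists2 m, m \in lattice_kappa [set b in B | (b <= y)%O] & (val s <= m)%O.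
Proof.
move=> sy; have y0 : y != \bot%O.
  by apply: contraTneq sy => ->; rewrite lex0 atom_neq0.
have [_ /(_ y y0)] := hB; set M := lattice_kappa _ => -[phi [[[phif _ phis] phile] phiin]].
have [g gM gs] := phis (val s) sy.
have [/existsP[m /andP[mM gm]]|/existsPn g0] := boolP [exists m in M, g m != \bot%O].
  exists m => //; have := gM m; rewrite mM => gmm; rewrite -gs in sy.
  suff <- : g m = val s by [].
  apply: le_atom => //; rewrite -(phiin m _ mM gmm) -gs.
  apply/phile => // [b|b bM].
    rewrite ffunE; have [->|bm] := eqVneq b m; first by rewrite mM.
    by rewrite le0x eqxx if_same.
  by rewrite ffunE; case: eqP => [->|_] //; rewrite le0x.
(* all components of g are bottom, so g is below the preimage h of bottom *)
have [h hM h0] := phis \bot%O (le0x y).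
case/negP: (atom_neq0 s); rewrite -lex0 -h0 -gs; apply/phile => // b bM.
by have := g0 b; rewrite bM /= negbK => /eqP->; rewrite le0x.
Qed.

(** Placing the atom in the factor m and placing it in the factor m' give the same
element of the interval below y, hence the same element of the product. *)
Lemma factors_disjoint y m m' s : y != \bot%O ->
  m \in lattice_kappa [set b in B | (b <= y)%O] ->
  m' \in lattice_kappa [set b in B | (b <= y)%O] ->
  (val s <= m)%O -> (val s <= m')%O -> m = m'.
Proof.
move=> y0; have [_ /(_ y y0)] := hB; set M := lattice_kappa _.
move=> [phi [[[_ phiinj _] _] phiin]] mM m'M sm sm'.
have inM b : b \in M -> (val s <= b)%O -> interval_prod_inj b (val s) \in interval_prod M.
  move=> bM sb; apply/mem_set => c; rewrite ffunE.
  have [->|cb] := eqVneq c b; first by rewrite bM.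
  by rewrite le0x eqxx if_same.
have /ffunP/(_ m) : interval_prod_inj m (val s) = interval_prod_inj m' (val s).
  by apply: phiinj; rewrite ?inM // !phiin.
rewrite !ffunE eqxx; case: eqP => // _ s0.
by have := atom_neq0 s; rewrite s0 eqxx.
Qed.

(** With y the join, b and b' are each below a factor of y; as they share an atom, it
is the same factor, which is then above y. *)
Lemma building_join b b' s : b \in B -> b' \in B ->
  (val s <= b)%O -> (val s <= b')%O -> (b `|` b')%O \in B.
Proof.
move=> bB b'B sb sb'; set y := (b `|` b')%O.
have y0 : y != \bot%O.
  by rewrite -lex0 leUx lex0 negb_and lattice_building_neq0.
have [|m mM bm] := @lattice_kappa_above [set b in B | (b <= y)%O] b.
  by rewrite inE bB leUl.
have [|m' m'M bm'] := @lattice_kappa_above [set b in B | (b <= y)%O] b'.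
  by rewrite inE b'B leUr.
have mm' := factors_disjoint y0 mM m'M (le_trans sb bm) (le_trans sb' bm').
move: (mM); rewrite inE => /andP[]; rewrite inE => /andP[mB my] _.
suff -> : y = m by [].
by apply/le_anti; rewrite my leUx bm mm' bm'.
Qed.

Lemma atom_in_building s : val s \in B.
Proof.
have [m] := atom_below_factor (lexx (val s)).
rewrite inE => /andP[]; rewrite inE => /andP[mB ms] _ sm.
by have <- : m = val s by apply/le_anti; rewrite ms.
Qed.

Local Notation BB := (boolean_closure [set atoms_below X | X in B]%SET).

Lemma atoms_below_in_closure b : b \in B -> atoms_below b \in BB.
Proof. by move=> bB; apply: (subsetP (boolean_closure_sub _)); exact: imset_f. Qed.

Lemma atoms_closure_building : boolean_building_set BB.
Proof.
apply: boolean_closure_building; apply/imsetP => -[b bB b0].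
have [s sb] := atom_below_exists (lattice_building_neq0 bB).
by have := in_set0 s; rewrite b0 inE sb.
Qed.

(** By [building_join], the non-empty sets of atoms whose join is in B form a boolean
building set; it contains every set [atoms_below b], b in B. *)
Lemma closure_join_in_building X : X \in BB -> (\join_(s in X) val s)%O \in B.
Proof.
pose J := [set X : {set atoms L} | (X != set0) && ((\join_(s in X) val s)%O \in B)].
have Jb : boolean_building_set J.
  apply/and3P; split; first by rewrite inE eqxx.
    apply/forallP => s; rewrite inE big_set1 atom_in_building andbT.
    by apply/set0Pn; exists s; rewrite set11.
  apply/'forall_implyP => Y; rewrite inE => /andP[Y0 YB].
  apply/'forall_implyP => Z; rewrite inE => /andP[Z0 ZB].
  apply/implyP => /set0Pn[s]; rewrite inE => /andP[sY sZ].
  rewrite inE setU_eq0 negb_and Y0 joins_setU.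
  by apply: (building_join (s := s)) => //; exact: joins_sup.
have BJ : [set atoms_below X | X in B]%SET \subset J.
  apply/subsetP => _ /imsetP[b bB ->]; rewrite inE join_atoms_below bB andbT.
  have [s sb] := atom_below_exists (lattice_building_neq0 bB).
  by apply/set0Pn; exists s; rewrite inE.
by move/(subsetP (boolean_closure_min Jb BJ)); rewrite inE => /andP[].
Qed.

Lemma sub_atoms_below_join (X : {set atoms L}) :
  X \subset atoms_below (\join_(s in X) val s)%O.
Proof. by apply/subsetP => s sX; rewrite inE; exact: joins_sup. Qed.

Lemma boolean_kappa_closure : boolean_kappa BB = @atoms_below _ L @: lattice_kappa B.
Proof.
apply/setP => Y; apply/idP/imsetP => [|[m mk ->]].
  rewrite inE => /andP[YB /'forall_implyP Ymax].
  have [m mk Ym] := lattice_kappa_above (closure_join_in_building YB).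
  exists m => //; apply/esym/eqP/(implyP (Ymax _ _)).
    by apply: atoms_below_in_closure; move: mk; rewrite inE => /andP[].
  by apply: subset_trans (sub_atoms_below_join Y) _; rewrite atoms_below_sub.
have mB : m \in B by move: mk; rewrite inE => /andP[].
rewrite inE atoms_below_in_closure //=; apply/'forall_implyP => Z ZB.
apply/implyP => mZ; have JZ := closure_join_in_building ZB.
rewrite eqEsubset mZ andbT -(lattice_kappa_max mk JZ) ?sub_atoms_below_join //.
by rewrite -{1}(join_atoms_below m) le_joins.
Qed.

(** The claim sep in the proof is the form in which nestedness in the lattice is used:
a subset C of N with at least two elements and with join in B contains two
distinct comparable elements. If C avoids the maximal elements this is the
definition; if C contains a maximal m, the join is m, which is above all of C. Two
crossing sets of atoms, or disjoint ones whose union is in the closure, would yield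
such a C without comparable elements. *)
Lemma nested_set_atoms_below N : lattice_nested_set B N ->
  boolean_nested_set BB (@atoms_below _ L @: N).
Proof.
case/and3P => /subsetP NB kN /forallP nest.
have sep (C : {set L}) : C \subset N -> (1 < #|C|)%N -> (\join_(b in C) b)%O \in B ->
    exists b b' s, [/\ b \in C, b' \in C, b != b', (b <= b')%O & (val s <= b)%O].
  move=> CN C2 JB.
  suff [b [b' [bC b'C bb' le]]] : exists b b', [/\ b \in C, b' \in C, b != b' & (b <= b')%O].
    have [s sb] := atom_below_exists (lattice_building_neq0 (NB b (subsetP CN b bC))).
    by exists b, b', s.
  have [Ck|/pred0Pn[m /andP[/= mC mk]]] := boolP [disjoint C & lattice_kappa B].
    have := nest C; rewrite subsetD CN Ck C2 JB /= implybF.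
    rewrite negb_forall => /existsP[b]; rewrite negb_imply => /andP[bC].
    rewrite negb_forall => /existsP[b']; rewrite 2!negb_imply => /and3P[b'C bb'].
    rewrite negbK => /orP[le|le]; first by exists b, b'.
    by exists b', b; rewrite eq_sym.
  have [b bC bm] : exists2 b, b \in C & b != m.
    have : (0 < #|C :\ m|)%N by rewrite (cardsD1 m C) mC ltnS in C2.
    by case/card_gt0P => b; rewrite !inE => /andP[bm bC]; exists b.
  exists b, m; split=> //; rewrite -(lattice_kappa_max mk JB); exact: joins_sup.
have disj b b' : b \in N -> b' \in N -> ~~ (b <= b')%O -> ~~ (b' <= b)%O ->
    [disjoint atoms_below b & atoms_below b'].
  move=> bN b'N bb' b'b; apply: contraT => /pred0Pn[s /=]; rewrite !inE => /andP[sb sb'].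
  have neq : b != b' by apply: contraNneq bb' => ->.
  have [|||c [c' [_ [+ + cc' le _]]]] := sep [set b; b'].
  - by apply/subsetP => c; rewrite !inE => /orP[]/eqP->.
  - by rewrite cards2 neq.
  - rewrite big_setU1 ?inE // big_set1; apply: (building_join (s := s)) => //; exact: NB.
  rewrite !inE => /orP[]/eqP cE /orP[]/eqP c'E; move: cc' le; rewrite cE c'E ?eqxx // => _.
    by rewrite (negPf bb').
  by rewrite (negPf b'b).
apply/and4P; split.
- by apply/subsetP => _ /imsetP[b bN ->]; exact/atoms_below_in_closure/NB.
- by rewrite boolean_kappa_closure imsetS.
- apply/'forall_implyP => _ /imsetP[b bN ->]; apply/'forall_implyP => _ /imsetP[b' b'N ->].
  rewrite !atoms_below_sub; have [//|bb'] := boolP (b <= b')%O.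
  by have [//|b'b] := boolP (b' <= b)%O; rewrite disj.
apply/forallP => C; apply/implyP => /and3P[CN C2 triv]; apply/negP => CB.
pose C' := [set b in N | atoms_below b \in C].
have C'N : C' \subset N by apply/subsetP => b; rewrite inE => /andP[].
have CE : C = @atoms_below _ L @: C'.
  apply/setP => X; apply/idP/imsetP => [XC|[b + ->]]; last by rewrite inE => /andP[].
  by have /imsetP[b bN XE] := subsetP CN X XC; exists b; rewrite ?inE ?bN -?XE.
have JE : (\join_(s in cover C) val s = \join_(b in C') b)%O.
  apply/le_anti/andP; split; apply/joinsP.
    move=> s /bigcupP[X]; rewrite CE => /imsetP[b bC' ->]; rewrite inE => sb.
    exact: le_trans sb (joins_sup _ bC').
  move=> b bC'; rewrite -(join_atoms_below b); apply: le_joins.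
  by apply: (bigcup_max (atoms_below b)) => //; rewrite CE imset_f.
have [|||b [b' [s [bC b'C bb' le sb]]]] := sep C' => //.
- by rewrite -(card_imset _ atoms_below_inj) -CE.
- by rewrite -JE closure_join_in_building.
have : [disjoint atoms_below b & atoms_below b'].
  apply: (trivIsetP triv); rewrite ?CE ?imset_f //.
  by apply: contraNneq bb' => /atoms_below_inj->.
by move=> /pred0P/(_ s) /=; rewrite !inE sb (le_trans sb le).
Qed.

Lemma nested_complex_atoms_below N : N \in lattice_nested_complex B ->
  @atoms_below _ L @: N \in boolean_nested_complex BB.
Proof.
case/lattice_nested_complexP => NB /nested_set_atoms_below; rewrite imsetU => nN.
apply/nested_complexP; rewrite boolean_kappa_closure; split=> //.
move: NB; rewrite !subsetD => /andP[/subsetP NB Nk]; apply/andP; split.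
  by apply/subsetP => _ /imsetP[b /NB bB ->]; exact: atoms_below_in_closure.
by rewrite (imset_disjoint atoms_below_inj).
Qed.

End Lattice.

Theorem corollary13p7 (R : realType) (disp : Order.disp_t)
    (L : finTBLatticeType disp) (hL : atomic L)
    (B : {set L}) (hB : lattice_building_set B) :
  let B' : {set {set atoms L}} :=
    boolean_closure [set atoms_below X | X in B]%SET in
  (exists Sigma : set (set {ffun atoms L -> R^o}),
     subfan Sigma (nested_fan B') /\
     realized_by (lattice_nested_complex B) Sigma
       (fun C D => (C `<=` D)%classic)) /\
  (forall lam : {set atoms L} -> R,
     (forall X, X \in B' -> (2 <= #|X|)%N -> 0 < lam X) ->
     exists K : set (set {ffun atoms L -> R^o}),
       polar_boundary_subcomplex (nestohedron B' lam) K /\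
       realized_by (lattice_nested_complex B) K
         (@polar_boundary_le R (atoms L))).
Proof.
move=> B'; have B'build : boolean_building_set B' by exact: atoms_closure_building.
pose Delta := [set @atoms_below _ L @: N | N : {set L} in lattice_nested_complex B].
have DeltaD N : N \in lattice_nested_complex B ->
    @atoms_below _ L @: N \in boolean_nested_complex B'.
  exact: nested_complex_atoms_below.
have Deltasub : Delta \subset boolean_nested_complex B'.
  by apply/subsetP => _ /imsetP[N /DeltaD + ->].
have Deltadown (A N : {set {set atoms L}}) : N \in Delta -> A \subset N -> A \in Delta.
  case/imsetP => N' N'D -> AN; apply/imsetP; exists (N' :&: @atoms_below _ L @^-1: A).
    by apply: lattice_nested_complex_sub N'D _; exact: subsetIl.
  apply/setP => X; apply/idP/imsetP => [XA|[b + ->]]; last by rewrite !inE => /andP[].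
  by have /imsetP[b bN XE] := subsetP AN X XA; exists b; rewrite ?inE ?bN -?XE.
split=> [|lam lam_gt0].
  exists [set C | exists2 N, N \in Delta & C = cone N (@indic_vec R (atoms L))]%classic.
  split; first exact: nested_subfan.
  apply: realized_by_imset => [|C|M N MD ND]; [exact: atoms_below_inj | by move=> x |].
  by apply: (nested_cone_sub B'build); apply: DeltaD.
exists [set F | exists2 N, N \in Delta & F = nested_face B' lam N]%classic.
split; first exact: nested_polar_boundary_subcomplex.
apply: realized_by_imset => [|C|M N MD ND]; [exact: atoms_below_inj | by move=> x |].
by apply: (nested_face_sub B'build lam_gt0); apply: DeltaD.
Qed.
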